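(* Let $k\geq 1$ be an integer. Let $D=(V,A)$ be a digraph whose underlying undirected graph is $2k$-edge-connected. Let $\mathcal{C}$ be a crossing family over ground set $V$, and let $f:\mathcal{C}\to\mathbb{Z}$ be a crossing submodular function such that $f(U)\geq\frac{1}{2}\left(d_A^+(U)-d_A^-(U)\right)$ for all $U\in\mathcal{C}$. Then $D$ has a $k$-arc-connected flip $J\subseteq A$ such that $f(U)\geq d_J^+(U)-d_J^-(U)$ for all $U\in\mathcal{C}$.
   Context: Digraphs are finite and may have parallel arcs. For a digraph $D=(V,A)$ and $U\subseteq V$, $\delta^+(U)$ and $\delta^-(U)$ denote the sets of arcs leaving and entering $U$, respectively. For $J\subseteq A$, $d_J^+(U):=|\delta^+(U)\cap J|$ and $d_J^-(U):=|\delta^-(U)\cap J|$. The underlying undirected graph is $2k$-edge-connected if $d_A^+(U)+d_A^-(U)\geq 2k$ for all $U\subsetneq V$, $U\neq\emptyset$. A $k$-arc-connected flip of $D$ is a subset $J\subseteq A$ such that after reversing the arcs of $J$ the digraph becomes (strongly) $k$-arc-connected, i.e. $d_J^+(U)+d_A^-(U)-d_J^-(U)\geq k$ for all $U\subsetneq V$, $U\neq\emptyset$. A family $\mathcal{C}$ of subsets of $V$ is a crossing family over ground set $V$ if for all $U,W\in\mathcal{C}$ with $U\cap W\neq\emptyset$ and $U\cup W\neq V$ we have $U\cap W,\,U\cup W\in\mathcal{C}$. A function $f:\mathcal{C}\to\mathbb{R}$ is crossing submodular over $\mathcal{C}$ if $f(U\cap W)+f(U\cup W)\leq f(U)+f(W)$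 for all $U,W\in\mathcal{C}$ with $U\cap W\neq\emptyset$ and $U\cup W\neq V$. *)

(* Defs.v *)
From HB Require Import structures.
From mathcomp Require Import all_boot all_order all_algebra.
Set Implicit Arguments.
Unset Strict Implicit.
Unset Printing Implicit Defensive.
Import Order.TTheory GRing.Theory Num.Theory.

(* Arcs form a type of their own, so parallel arcs are distinct arcs with the
   same ends.  Loops are not excluded; they never leave or enter a set. *)
Record digraph (V A : finType) := Digraph { tail : A -> V; head : A -> V }.

Definition out_arcs (V A : finType) (D : digraph V A) (U : {set V}) : {set A} :=
  [set a | (tail D a \in U) && (head D a \notin U)].

Definition in_arcs (V A : finType) (D : digraph V A) (U : {set V}) : {set A} :=
  [set a | (tail D a \notin U) && (head D a \in U)].

Definition dout (V A : finType) (D : digraph V A) (J : {set A}) (U : {set V})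
  : nat := #|out_arcs D U :&: J|.

Definition din (V A : finType) (D : digraph V A) (J : {set A}) (U : {set V})
  : nat := #|in_arcs D U :&: J|.

Definition underlying_edge_connected (V A : finType) (D : digraph V A)
    (m : nat) : Prop :=
  forall U : {set V}, U \proper [set: V] -> U != set0 ->
    m <= dout D [set: A] U + din D [set: A] U.

(* Bounding the entering arcs suffices: U ranges over complements as well. *)
Definition arc_connected (V A : finType) (D : digraph V A) (k : nat) : Prop :=
  forall U : {set V}, U \proper [set: V] -> U != set0 ->
    k <= din D [set: A] U.

Definition reverse_arcs (V A : finType) (D : digraph V A) (J : {set A})
  : digraph V A :=
  Digraph (fun a => if a \in J then head D a else tail D a)
          (fun a => if a \in J then tail D a else head D a).

Definition arc_connected_flip (V A : finType) (D : digraph V A) (k : nat)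
    (J : {set A}) : Prop := arc_connected (reverse_arcs D J) k.

Definition crossing (V : finType) (U W : {set V}) : Prop :=
  U :&: W != set0 /\ U :|: W != [set: V].

Definition crossing_family (V : finType) (C : {set {set V}}) : Prop :=
  forall U W : {set V}, U \in C -> W \in C -> crossing U W ->
    U :&: W \in C /\ U :|: W \in C.

(* A function on C is represented by a function on all subsets of V whose
   values outside C are irrelevant. *)
Definition crossing_submodular (R : numDomainType) (V : finType)
    (C : {set {set V}}) (f : {set V} -> R) : Prop :=
  forall U W : {set V}, U \in C -> W \in C -> crossing U W ->
    (f (U :&: W) + f (U :|: W) <= f U + f W)%R.

Lemma din_reverse_arcs (V A : finType) (D : digraph V A) (J : {set A})
    (U : {set V}) :
  ((din (reverse_arcs D J) [set: A] U)%:Z =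
     (dout D J U)%:Z + (din D [set: A] U)%:Z - (din D J U)%:Z)%R.
Proof.
have -> : din (reverse_arcs D J) [set: A] U
          = dout D J U + #|in_arcs D U :\: J|.
  rewrite /din setIT -(cardsID J); congr (_ + _); apply: eq_card => a;
    rewrite !inE /=; case: (a \in J); rewrite ?andbF ?andbT //=.
  by rewrite andbC.
by rewrite /din setIT -(cardsID J (in_arcs D U)) !PoszD addrA addrAC addrK.
Qed.

Lemma arc_connected_flipE (V A : finType) (D : digraph V A) (k : nat)
    (J : {set A}) :
  arc_connected_flip D k J <->
  (forall U : {set V}, U \proper [set: V] -> U != set0 ->
     (k%:Z <= (dout D J U)%:Z + (din D [set: A] U)%:Z - (din D J U)%:Z)%R).
Proof.
by split=> H U pU nU; have := H U pU nU; rewrite -din_reverse_arcs lez_nat.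
Qed.

(* Main.v *)
Require Import Defs.
From mathcomp Require Import all_boot all_order all_algebra.
From mathcomp Require Import zify lra.
Import Order.TTheory GRing.Theory Num.Theory.

Set Implicit Arguments.
Unset Strict Implicit.
Unset Printing Implicit Defensive.

Local Open Scope ring_scope.

(** A flip J matters only through the vector y that gives each vertex its net
outdegree in J: the sum of y over a vertex set U is [d_J^+(U) - d_J^-(U)].
The bounds imposed by f therefore bound such sums, and, applied to
complements, k-arc-connectivity after the flip says that they are at most
[d_A^+(U) - k] for every nonempty proper U. The latter bound is crossing
submodular too, so that y has to be an integral common base of two crossing
submodular functions. Half of the net outdegree in A is a common base: for f
by hypothesis, for the other function because the underlying graph is
2k-edge-connected. It is only half-integral, and two facts finish the proof.

Two integral crossing submodular functions with a rational common base have
an integral one ([integral_common_base]). Sets that are tight at x form a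
crossing family, and x has an integral sum on each class of vertices that no
tight set separates ([atom_sum_int]). Hence a class containing a fractional
vertex contains two, for either function, and counting dimensions yields a
nonzero direction d that lives on the fractional vertices and vanishes on all
classes, hence on all tight sets ([balanced_direction]). Moving x along d
until a further set becomes tight or a coordinate becomes an integer keeps
what was tight or integral; repeat.

An integral y of total 0 whose sum on each U is at most [d_A^+(U)] is the net
outdegree of some set of arcs ([net_out_realization]). Decide on one arc at a
time: if it could be neither taken nor discarded, the two violated bounds
would contradict submodularity of the outdegree. *)

(** * Integral sums from crossing families *)

Lemma sum_setIU (R : nmodType) (T : finType) (x : T -> R) (U W : {set T}) :
  \sum_(v in U :&: W) x v + \sum_(v in U :|: W) x v
    = \sum_(v in U) x v + \sum_(v in W) x v.
Proof.
rewrite (big_setID U (A := U :|: W)) /= setUK setDUl setDv set0U.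
by rewrite [\sum_(v in W) _](big_setID U) /= setIC addrCA.
Qed.

Lemma sum_setT (R : nmodType) (T : finType) (x : T -> R) :
  \sum_(v in [set: T]) x v = \sum_v x v.
Proof. by apply: eq_bigl => v; rewrite inE. Qed.

(** The maximal members of F are pairwise disjoint and cover what F covers. *)
Lemma cover_sum_int (T : finType) (F : {set {set T}}) (x : T -> rat) :
  (forall W W', W \in F -> W' \in F -> W :&: W' != set0 -> W :|: W' \in F) ->
  (forall W, W \in F -> \sum_(v in W) x v \is a Num.int) ->
  \sum_(v in cover F) x v \is a Num.int.
Proof.
move=> FU Fint; pose M := [set W in F | maxset [in F] W].
have MF W : W \in M -> W \in F by rewrite inE => /andP[].
have trivM : trivIset M.
  apply/trivIsetP => W W' MW MW'; apply: contraNT; rewrite -setI_eq0 => WW'.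
  have FWW' := FU _ _ (MF _ MW) (MF _ MW') WW'.
  move: MW MW'; rewrite !inE.
  move=> /andP[_ /maxsetP[_ maxW]] /andP[_ /maxsetP[_ maxW']].
  by rewrite -(maxW _ FWW' (subsetUl _ _)) {1}(maxW' _ FWW' (subsetUr _ _)).
have -> : cover F = cover M.
  apply/eqP; rewrite eqEsubset; apply/andP; split; apply/bigcupsP => W FW.
    have [W' maxW' sWW'] := maxset_exists (P := [in F]) FW.
    apply: subset_trans sWW' (bigcup_sup W' _).
    by rewrite inE maxW' andbT; case/maxsetP: maxW'.
  exact: bigcup_sup (MF _ FW).
by rewrite big_trivIset //=; apply: rpred_sum => W /MF; apply: Fint.
Qed.

Definition hull (T : finType) (F : {set {set T}}) (u : T) : {set T} :=
  \bigcap_(U in F | u \in U) U.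

(** The class of u when points that no member of F separates are identified. *)
Definition atom (T : finType) (F : {set {set T}}) (u : T) : {set T} :=
  [set v | [forall U in F, (u \in U) == (v \in U)]].

Lemma hullP (T : finType) (F : {set {set T}}) (u v : T) :
  reflect (forall U, U \in F -> u \in U -> v \in U) (v \in hull F u).
Proof.
apply: (iffP bigcapP) => H U; first by move=> FU uU; apply: H; rewrite FU.
by case/andP; apply: H.
Qed.

Lemma atomP (T : finType) (F : {set {set T}}) (u v : T) :
  reflect (forall U, U \in F -> (u \in U) = (v \in U)) (v \in atom F u).
Proof.
rewrite inE; apply: (iffP forall_inP) => H U /H; first by move/eqP.
by move=> ->.
Qed.

Lemma atom_refl (T : finType) (F : {set {set T}}) (u : T) : u \in atom F u.
Proof. exact/atomP. Qed.

Lemma eq_atom (T : finType) (F : {set {set T}}) (u v : T) :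
  (atom F v == atom F u) = (v \in atom F u).
Proof.
apply/eqP/idP => [<-|/atomP uv]; first exact: atom_refl.
by apply/setP => w; apply/atomP/atomP => H U FU; rewrite -H // uv.
Qed.

(** The members of a crossing family that contain u have complements that all
miss u, so two complements that meet come from crossing sets. The complement
of the hull is thus covered by a family to which [cover_sum_int] applies. *)
Lemma hull_sum_int (T : finType) (F : {set {set T}}) (x : T -> rat) (u : T) :
  crossing_family F ->
  (forall U, U \in F -> \sum_(v in U) x v \is a Num.int) ->
  \sum_v x v \is a Num.int ->
  \sum_(v in hull F u) x v \is a Num.int.
Proof.
move=> crossF Fint Tint.
have setC_sum (U : {set T}) :
    \sum_(v in U) x v = \sum_v x v - \sum_(v in ~: U) x v.
  rewrite [\sum_v _](bigID [in U]) /= [X in _ = _ + X - _](eq_bigl [in ~: U]).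
    by rewrite addrK.
  by move=> v; rewrite inE.
pose Fc := [set W | (~: W \in F) && (u \notin W)].
have -> : hull F u = ~: cover Fc.
  apply/setP => v; rewrite inE; apply/hullP/negP.
    move=> H /bigcupP[W]; rewrite inE => /andP[FW uW].
    by have := H _ FW; rewrite !inE uW => /(_ isT)/negP.
  move=> H U FU uU; apply/negPn/negP => vU; apply: H; apply/bigcupP.
  by exists (~: U); rewrite inE ?setCK ?FU //= inE uU.
rewrite setC_sum setCK rpredB //; apply: cover_sum_int => [W W'|W]; rewrite !inE.
  case/andP => FW uW /andP[FW' uW'] WW'; rewrite negb_or uW uW' andbT setCU.
  have [|-> _ //] := crossF _ _ FW FW'; split.
    by apply/set0Pn; exists u; rewrite !inE uW.
  by rewrite -setCI -setC0 (inj_eq (@setC_inj _)).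
by case/andP=> FW _; rewrite setC_sum rpredB ?Fint.
Qed.

(** The hull of u is the atom of u together with atoms of points whose hulls
are strictly smaller; induct on the size of the hull. *)
Lemma atom_sum_int (T : finType) (F : {set {set T}}) (x : T -> rat) (u : T) :
  crossing_family F ->
  (forall U, U \in F -> \sum_(v in U) x v \is a Num.int) ->
  \sum_v x v \is a Num.int ->
  \sum_(v in atom F u) x v \is a Num.int.
Proof.
move=> crossF Fint Tint.
have [n] := ubnP #|hull F u|; elim: n u => // n IHn u; rewrite ltnS => le_n.
have hull_trans v : v \in hull F u -> hull F v \subset hull F u.
  move/hullP=> uv; apply/subsetP => w /hullP vw; apply/hullP => U FU uU.
  exact/vw/uv.
have atom_hull v w : w \in atom F v -> w \in hull F v.
  by move/atomP=> vw; apply/hullP => U FU; rewrite vw.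
have := hull_sum_int u crossF Fint Tint.
rewrite (partition_big (atom F) predT) //= (bigD1 (atom F u)) //=.
rewrite (eq_bigl [in atom F u]); last first.
  move=> v /=; rewrite eq_atom andb_idl //; exact: atom_hull.
rewrite rpredDr //; apply: rpred_sum => X /= neX.
have [v /andP[uv /eqP vX]|none] :=
    pickP [pred v | (v \in hull F u) && (atom F v == X)]; last first.
  by rewrite big_pred0.
rewrite (eq_bigl [in atom F v]); last first.
  move=> w /=; rewrite -vX eq_atom andb_idl // => /atom_hull.
  exact/subsetP/hull_trans.
(* If u were in the hull of v, no member of F would separate u from v. *)
apply: IHn; apply: leq_trans le_n; apply: proper_card.
rewrite properE hull_trans //=.
apply/negP => /subsetP uv'; apply: (negP neX); rewrite -vX eq_atom.
apply/atomP => U FU; apply/idP/idP; first exact: (hullP _ _ _ uv).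
have /hullP : u \in hull F v by apply: uv'; apply/hullP.
by apply.
Qed.

Lemma atom_fractional_partner (T : finType) (F : {set {set T}}) (x : T -> rat)
    (u : T) :
  crossing_family F ->
  (forall U, U \in F -> \sum_(v in U) x v \is a Num.int) ->
  \sum_v x v \is a Num.int ->
  x u \isn't a Num.int ->
  exists2 w, w \in atom F u & (w != u) && (x w \isn't a Num.int).
Proof.
move=> crossF Fint Tint xu.
have [w /and3P[uw wu xw]|none] :=
    pickP [pred w | [&& w \in atom F u, w != u & x w \isn't a Num.int]].
  by exists w; rewrite ?wu.
case/negP: xu; have := atom_sum_int u crossF Fint Tint.
rewrite (bigD1 u) ?atom_refl //= rpredDr //; apply: rpred_sum => w /andP[uw wu].
by have /negbT := none w; rewrite /= uw wu /= negbK.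
Qed.

(** * A direction balanced on two partitions *)

Lemma card_imset_paired (T K : finType) (c : T -> K) (S : {set T}) :
  (forall v, v \in S -> exists2 w, w \in S & (w != v) && (c w == c v)) ->
  (#|c @: S| * 2 <= #|S|)%N.
Proof.
move=> paired; rewrite -[#|S|]sum1_card (partition_big_imset c) /=.
rewrite -sum_nat_const; apply: leq_sum => X /imsetP[v vS ->].
have [w wS /andP[wv cwv]] := paired v vS.
rewrite (bigD1 v) ?vS ?eqxx //= (bigD1 w) /= ?wS ?cwv ?wv //.
Qed.

(** The classes of c1 and of c2 impose one linear equation each on a vector
indexed by S. As each class has at least two points there are at most #|S|
equations, and one of them is redundant because the classes of c1 and those of
c2 have the same total; so a nonzero solution exists. *)
Lemma balanced_direction (T K1 K2 : finType) (c1 : T -> K1) (c2 : T -> K2)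
    (S : {set T}) (v0 : T) :
  v0 \in S ->
  (forall v, v \in S -> exists2 w, w \in S & (w != v) && (c1 w == c1 v)) ->
  (forall v, v \in S -> exists2 w, w \in S & (w != v) && (c2 w == c2 v)) ->
  exists d : T -> rat,
    [/\ exists v, d v != 0, forall v, v \notin S -> d v = 0,
        forall X, \sum_(v | c1 v == X) d v = 0
      & forall X, \sum_(v | c2 v == X) d v = 0].
Proof.
move=> v0S paired1 paired2.
(* The equation of the class of v0 under c2 is the redundant one. *)
pose K1S := c1 @: S; pose K2S := c2 @: S :\ c2 v0.
have ltS : (#|K1S| + #|K2S| < #|S|)%N.
  have := card_imset_paired paired1; have := card_imset_paired paired2.
  by rewrite (cardsD1 (c2 v0) (c2 @: S)) imset_f //= /K1S /K2S; lia.
pose B1 := \matrix_(i < #|S|, j < #|K1S|)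
  ((c1 (enum_val i) == enum_val j)%:R : rat).
pose B2 := \matrix_(i < #|S|, j < #|K2S|)
  ((c2 (enum_val i) == enum_val j)%:R : rat).
have /rowV0Pn[r /sub_kermxP] : kermx (row_mx B1 B2) != 0.
  rewrite -mxrank_eq0 mxrank_ker -lt0n subn_gt0.
  exact: leq_ltn_trans (rank_leq_col _) ltS.
rewrite mul_mx_row => /eqP; rewrite row_mx_eq0.
move=> /andP[/eqP rB1 /eqP rB2] r_neq0.
pose d v := if v \in S then r 0 (enum_rank_in v0S v) else 0.
have d_enum i : d (enum_val i) = r 0 i by rewrite /d enum_valP enum_valK_in.
have sumS (P : pred T) :
    \sum_(v | P v) d v = \sum_(i < #|S|) r 0 i * (P (enum_val i))%:R.
  rewrite (bigID [in S]) /= addrC big1 ?add0r; last first.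
    by move=> v /andP[_ /negbTE vS]; rewrite /d vS.
  under eq_bigl => v do rewrite andbC.
  rewrite big_enum_val_cond /= big_mkcond /=; apply: eq_bigr => i _.
  by rewrite d_enum; case: (P _); rewrite ?mulr1 ?mulr0.
have sum_keys (K : finType) (c : T -> K) (X : K) :
    X \notin c @: S -> \sum_(v | c v == X) d v = 0.
  move=> XS; apply: big1 => v /eqP cv; rewrite /d ifN //.
  by apply: contraNN XS => vS; rewrite -cv imset_f.
have sum1 X : \sum_(v | c1 v == X) d v = 0.
  have [XS|] := boolP (X \in K1S); last exact: sum_keys.
  move/rowP/(_ (enum_rank_in XS X)): rB1; rewrite !mxE => rB1.
  rewrite sumS -[RHS]rB1; apply: eq_bigr => i _.
  by rewrite mxE enum_rankK_in.
have sum2 X : X != c2 v0 -> \sum_(v | c2 v == X) d v = 0.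
  move=> X0; have [XS|] := boolP (X \in K2S); last first.
    by rewrite !inE X0; apply: sum_keys.
  move/rowP/(_ (enum_rank_in XS X)): rB2; rewrite !mxE => rB2.
  rewrite sumS -[RHS]rB2; apply: eq_bigr => i _.
  by rewrite mxE enum_rankK_in.
exists d; split=> //.
- case/rV0Pn: r_neq0 => i ri; exists (enum_val i); by rewrite d_enum.
- by move=> v /negbTE vS; rewrite /d vS.
- move=> X; have [->|/sum2//] := eqVneq X (c2 v0).
  have tot : \sum_v d v = 0.
    by rewrite (partition_big c1 predT) //= big1.
  move: tot; rewrite (partition_big c2 predT) //= (bigD1 (c2 v0)) //=.
  by rewrite [X in _ + X]big1 ?addr0 // => X' /sum2.
Qed.

(** The ratio test: s lists the slacks of constraints and r the rates at which
a move consumes them. *)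
Lemma ratio_test (I : finType) (s r : I -> rat) (i0 : I) :
  (forall i, 0 < r i -> 0 < s i) -> (forall i, 0 <= s i) -> 0 < r i0 ->
  exists2 e, (forall i, e * r i <= s i)
    & exists2 i, 0 < r i & e * r i = s i.
Proof.
move=> rs s_ge0 r0.
have [i ri min_i] := arg_minP (fun i => s i / r i) (P := fun i => 0 < r i) r0.
have e_gt0 : 0 < s i / r i by rewrite divr_gt0 ?rs.
exists (s i / r i); last by exists i; rewrite // divfK ?gt_eqF.
move=> j; have [rj|rj] := ltP 0 (r j); first by rewrite -ler_pdivlMr ?min_i.
by apply: le_trans (s_ge0 j); rewrite pmulr_rle0.
Qed.

(** * Common bases of two crossing submodular functions *)

Definition tight (V : finType) (C : {set {set V}}) (f : {set V} -> int)
    (x : V -> rat) : {set {set V}} :=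
  [set U in C | \sum_(v in U) x v == (f U)%:~R].

(** Submodularity of f against modularity of x forces equality in both of the
bounds for the intersection and the union. *)
Lemma tight_crossing (V : finType) (C : {set {set V}}) (f : {set V} -> int)
    (x : V -> rat) :
  crossing_family C -> crossing_submodular C f ->
  (forall U, U \in C -> \sum_(v in U) x v <= (f U)%:~R) ->
  crossing_family (tight C f x).
Proof.
move=> crossC subf x_le U W; rewrite !inE.
move=> /andP[CU /eqP xU] /andP[CW /eqP xW] UW.
have [CI CU'] := crossC _ _ CU CW UW; have := subf _ _ CU CW UW.
rewrite CI CU' /= -(ler_int rat) !intrD -xU -xW.
rewrite -sum_setIU.
have := x_le _ CI; have := x_le _ CU'.
by move=> le1 le2 le3; split; lra.
Qed.

Lemma sum_atoms0 (T : finType) (F : {set {set T}}) (d : T -> rat) (U : {set T}) :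
  (forall X, \sum_(v | atom F v == X) d v = 0) -> U \in F ->
  \sum_(v in U) d v = 0.
Proof.
move=> d0 FU; rewrite (partition_big (atom F) predT) //= big1 // => X _.
have [v /andP[uv /eqP <-]|none] := pickP [pred v | (v \in U) && (atom F v == X)].
  rewrite -[RHS](d0 (atom F v)); apply: eq_bigl => w /=.
  by rewrite andb_idl // eq_atom => /atomP <-.
by rewrite big_pred0.
Qed.

(** Indexing the two functions by a boolean lets the tight sets of both be
counted together. The measure that decreases is the number of pairs (function,
set) that are not tight plus the number of fractional coordinates. *)
Lemma integral_common_base (V : finType) (C : bool -> {set {set V}})
    (f : bool -> {set V} -> int) (x : V -> rat) :
  (forall b, crossing_family (C b)) ->
  (forall b, crossing_submodular (C b) (f b)) ->
  (forall b U, U \in C b -> \sum_(v in U) x v <= (f b U)%:~R) ->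
  \sum_v x v = 0 ->
  exists y : V -> int,
    (forall b U, U \in C b -> \sum_(v in U) y v <= f b U) /\ \sum_v y v = 0.
Proof.
move=> crossC subf.
pose tightp z := [set p : bool * {set V} | p.2 \in tight (C p.1) (f p.1) z].
pose intp z := [set v : V | (z v : rat) \is a Num.int].
pose slackness z := (#|~: tightp z| + #|~: intp z|)%N.
have [n] := ubnP (slackness x); elim: n x => // n IHn x.
rewrite ltnS => le_n x_le x0.
pose S := ~: intp x.
have [S0|[u uS]] := set_0Vmem S.
  have x_int v : x v = (Num.floor (x v))%:~R.
    apply/esym/eqP; rewrite -intrEfloor.
    by have := in_set0 v; rewrite -S0 !inE => /negbFE.
  exists (Num.floor \o x); split=> [b U CU|].
    rewrite -(ler_int rat) rmorph_sum /=; under eq_bigr do rewrite -x_int.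
    exact: x_le.
  apply/eqP; rewrite -(eqr_int rat) rmorph_sum /=; apply/eqP.
  by under eq_bigr do rewrite -x_int.
pose F b := tight (C b) (f b) x.
have crossF b : crossing_family (F b).
  exact: tight_crossing (crossC b) (subf b) (x_le b).
have Fint b U : U \in F b -> \sum_(v in U) x v \is a Num.int.
  by rewrite inE => /andP[_ /eqP ->].
have Tint : \sum_v x v \is a Num.int by rewrite x0.
have paired b v : v \in S ->
    exists2 w, w \in S & (w != v) && (atom (F b) w == atom (F b) v).
  rewrite !inE => xv; have [w vw /andP[wv xw]] :=
    atom_fractional_partner (crossF b) (@Fint b) Tint xv.
  by exists w; rewrite ?inE // wv eq_atom vw.
have [d [[v1 dv1] dS d1 d2]] :=
  balanced_direction uS (paired true) (paired false).
have dF b U : U \in F b -> \sum_(v in U) d v = 0.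
  by case: b; [apply: sum_atoms0 d1|apply: sum_atoms0 d2].
have dV : \sum_v d v = 0.
  by rewrite (partition_big (atom (F true)) predT) //= big1.
have [v0 d0] : exists v0, 0 < d v0.
  apply/existsP; apply: contraNT dv1; rewrite negb_exists => /forallP d_le0.
  have /eqP : \sum_v (- d v) = 0 by rewrite sumrN dV oppr0.
  rewrite psumr_eq0 => [/allP/(_ v1 (mem_index_enum _))|v _].
    by rewrite oppr_eq0.
  by rewrite oppr_ge0 leNgt.
have v0S : v0 \in S by apply: contraLR d0 => /dS ->; rewrite ltxx.
(* Pairs outside the families get slack and rate 0, so they never limit the
   move; [None] stands for v0 reaching the next integer. *)
pose slack (o : option (bool * {set V})) : rat :=
  if o is Some (b, U) then
    if U \in C b then (f b U)%:~R - \sum_(v in U) x v else 0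
  else (Num.floor (x v0) + 1)%:~R - x v0.
pose rate (o : option (bool * {set V})) : rat :=
  if o is Some (b, U) then
    if U \in C b then \sum_(v in U) d v else 0
  else d v0.
have slack_ge0 o : 0 <= slack o.
  case: o => [[b U]|] /=; first by case: ifP => // CU; rewrite subr_ge0 x_le.
  by rewrite subr_ge0 ltW // floorD1_gt.
have rate_slack o : 0 < rate o -> 0 < slack o.
  move=> ro; rewrite lt_def slack_ge0 andbT; apply: contraTneq ro.
  case: o => [[b U]|] /=; last first.
    by move/eqP; rewrite subr_eq0 => /eqP E; move: v0S; rewrite !inE -E intr_int.
  case: ifP => CU; last by rewrite ltxx.
  move=> /eqP; rewrite subr_eq0 => /eqP E.
  by rewrite (dF b) ?ltxx // inE CU E eqxx.
have [e e_le [o ro e_eq]] := ratio_test (i0 := None) rate_slack slack_ge0 d0.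
pose x' v := x v + e * d v.
have sum_x' (P : pred V) :
    \sum_(v | P v) x' v = \sum_(v | P v) x v + e * \sum_(v | P v) d v.
  by rewrite big_split mulr_sumr.
apply: (IHn x'); last 2 first.
- by move=> b U CU; rewrite sum_x'; have := e_le (Some (b, U)); rewrite /= CU; lra.
- by rewrite sum_x' dV x0 mulr0 addr0.
apply: leq_trans le_n.
have sub_tight : ~: tightp x' \subset ~: tightp x.
  rewrite setCS; apply/subsetP => -[b U]; rewrite !inE /= => /andP[CU xU].
  by rewrite CU sum_x' (dF b) ?inE ?CU //= mulr0 addr0.
have sub_int : ~: intp x' \subset ~: intp x.
  rewrite setCS; apply/subsetP => v xv; have: d v = 0 by rewrite dS // inE xv.
  by move: xv; rewrite !inE /x' => xv ->; rewrite mulr0 addr0.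
case: o ro e_eq => [[b U]|] /=; last first.
  move=> _ e_eq; rewrite /slackness -addnS leq_add ?subset_leq_card //.
  apply: proper_card; rewrite properE sub_int; apply/subsetPn; exists v0 => //.
  by rewrite !inE negbK /x' e_eq addrC subrK intr_int.
case: ifP => [CU rU e_eq|_]; last by rewrite ltxx.
rewrite /slackness -addSn leq_add ?subset_leq_card //.
apply: proper_card; rewrite properE sub_tight; apply/subsetPn; exists (b, U).
  by rewrite inE; apply: contraTN rU; rewrite inE /= => /(dF b) ->; rewrite ltxx.
by rewrite !inE /= CU sum_x' e_eq addrC subrK eqxx.
Qed.

(** * Net outdegrees of arc sets *)

Lemma dout_sum (V A : finType) (D : digraph V A) (J : {set A}) (U : {set V}) :
  dout D J U = (\sum_(a in J) ((tail D a \in U) && (Defs.head D a \notin U)))%N.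
Proof.
rewrite /dout -sum1_card big_mkcond [RHS]big_mkcond; apply: eq_bigr => a _ /=.
by rewrite !inE; case: (a \in J); case: (tail D a \in U); case: (Defs.head D a \in U).
Qed.

Lemma din_sum (V A : finType) (D : digraph V A) (J : {set A}) (U : {set V}) :
  din D J U = (\sum_(a in J) ((tail D a \notin U) && (Defs.head D a \in U)))%N.
Proof.
rewrite /din -sum1_card big_mkcond [RHS]big_mkcond; apply: eq_bigr => a _ /=.
by rewrite !inE; case: (a \in J); case: (tail D a \in U); case: (Defs.head D a \in U).
Qed.

Lemma dout_submodular (V A : finType) (D : digraph V A) (J : {set A})
    (U W : {set V}) :
  (dout D J (U :&: W) + dout D J (U :|: W) <= dout D J U + dout D J W)%N.
Proof.
rewrite !dout_sum -!big_split; apply: leq_sum => a _ /=; rewrite !inE.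
by do 4!case: (_ \in _).
Qed.

Lemma dout_setC (V A : finType) (D : digraph V A) (J : {set A}) (U : {set V}) :
  dout D J (~: U) = din D J U.
Proof.
by rewrite dout_sum din_sum; apply: eq_bigr => a _; rewrite !inE negbK.
Qed.

Definition net_out (V A : finType) (D : digraph V A) (J : {set A}) (v : V) : int :=
  \sum_(a in J) ((tail D a == v)%:Z - (Defs.head D a == v)%:Z).

Lemma sum_eq_in (V : finType) (s : V) (U : {set V}) :
  \sum_(v in U) (s == v)%:Z = (s \in U)%:Z.
Proof.
rewrite big_mkcond (bigD1 s) //= eqxx big1 => [|v vs]; first by case: (s \in U).
by rewrite eq_sym (negbTE vs); case: ifP.
Qed.

Lemma sum_net_out (V A : finType) (D : digraph V A) (J : {set A}) (U : {set V}) :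
  \sum_(v in U) net_out D J v = (dout D J U)%:Z - (din D J U)%:Z.
Proof.
rewrite exchange_big /= dout_sum din_sum !(big_morph Posz PoszD (erefl _)) -sumrB.
apply: eq_bigr => a _; rewrite sumrB !sum_eq_in.
by case: (_ \in _); case: (_ \in _).
Qed.

(** Induction on the number of arcs available. Discarding the arc a from s to t
fails only if a leaves a set U that needs all its arcs, and taking a fails only
if a enters a set W that needs all its other arcs. As a leaves neither the
intersection nor the union of U and W, one of these violates its bound. *)
Lemma net_out_realization (V A : finType) (D : digraph V A) (B : {set A})
    (y : V -> int) :
  \sum_v y v = 0 ->
  (forall U : {set V}, \sum_(v in U) y v <= (dout D B U)%:Z) ->
  exists2 J : {set A}, J \subset B &
    forall U : {set V}, \sum_(v in U) y v = (dout D J U)%:Z - (din D J U)%:Z.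
Proof.
have [n] := ubnP #|B|; elim: n B y => // n IHn B y; rewrite ltnS => le_n y0 y_le.
have [B0|[a aB]] := set_0Vmem B.
  exists set0 => [|U]; first exact: sub0set.
  rewrite /dout /din !setI0 cards0 subrr.
  have := y_le U; have := y_le (~: U); rewrite B0 /dout !setI0 cards0.
  have: \sum_(v in U) y v + \sum_(v in ~: U) y v = 0.
    rewrite -[RHS]y0 [RHS](bigID [in U]) /=; congr (_ + _).
    by apply: eq_bigl => v; rewrite inE.
  by lia.
pose B' := B :\ a; pose s := tail D a; pose t := Defs.head D a.
have lt_n : (#|B'| < n)%N
  by move: le_n; rewrite (cardsD1 a B) aB.
have doutB U : dout D B U = (((s \in U) && (t \notin U)) + dout D B' U)%N.
  by rewrite !dout_sum (big_setD1 a).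
have [/forallP ok|/forallPn[U]] :=
    boolP [forall U : {set V}, \sum_(v in U) y v <= (dout D B' U)%:Z].
  have [J sJ yJ] := IHn B' y lt_n y0 ok.
  by exists J => //; apply: subset_trans sJ (subD1set _ _).
rewrite -ltNge => y_gtU.
pose y' v : int := y v - ((s == v)%:Z - (t == v)%:Z).
have sum_y' (W : {set V}) :
    \sum_(v in W) y' v = \sum_(v in W) y v - ((s \in W)%:Z - (t \in W)%:Z).
  by rewrite sumrB sumrB !sum_eq_in.
have [/forallP ok|/forallPn[W]] :=
    boolP [forall W : {set V}, \sum_(v in W) y' v <= (dout D B' W)%:Z].
  have y'0 : \sum_v y' v = 0.
    by have := sum_y' setT; rewrite !sum_setT y0 !in_setT !subrr.
  have [J sJ yJ] := IHn B' y' lt_n y'0 ok.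
  have aJ : a \notin J.
    apply: contraTN sJ => aJ; apply/subsetPn.
    by exists a; rewrite ?inE ?eqxx.
  exists (a |: J) => [|X].
    by rewrite subUset sub1set aB (subset_trans sJ) ?subD1set.
  have := yJ X; rewrite sum_y' !dout_sum !din_sum !big_setU1 //= -/s -/t.
  by case: (s \in X); case: (t \in X) => /=; lia.
rewrite -ltNge sum_y' => y_gtW.
(* [m] makes all sums over y one and the same atom for [lia]. *)
pose m (X : {set V}) : int := \sum_(v in X) y v.
have m_le X : m X <= (dout D B X)%:Z := y_le X.
have m_modular : m (U :&: W) + m (U :|: W) = m U + m W := sum_setIU y U W.
have {y_gtU} m_gtU : (dout D B' U)%:Z < m U := y_gtU.
have {y_gtW} : (dout D B' W)%:Z < m W - ((s \in W)%:Z - (t \in W)%:Z) := y_gtW.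
move: m_modular m_gtU (dout_submodular D B' U W).
move: (m_le U) (m_le W) (m_le (U :&: W)) (m_le (U :|: W)).
rewrite !doutB !inE; clearbody m.
by case: (s \in U); case: (t \in U); case: (s \in W); case: (t \in W) => /=; lia.
Qed.

(** * The flip *)

Local Close Scope ring_scope.

Theorem theorem10 (k : nat) (k_ge1 : 1 <= k)
    (V A : finType) (D : digraph V A)
    (connD : underlying_edge_connected D (2 * k))
    (C : {set {set V}}) (crossC : crossing_family C)
    (f : {set V} -> int) (submodf : crossing_submodular C f)
    (f_ge : forall U : {set V}, U \in C ->
       (1 / 2 * ((dout D [set: A] U)%:Q - (din D [set: A] U)%:Q)
          <= (f U)%:Q :> rat)%R) :
  exists J : {set A},
    arc_connected_flip D k J /\
    forall U : {set V}, U \in C ->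
      ((dout D J U)%:Z - (din D J U)%:Z <= f U)%R.
Proof.
pose P := [set U : {set V} | (U \proper [set: V]) && (U != set0)].
pose g U : int := ((dout D setT U)%:Z - k%:Z)%R.
have crossP : crossing_family P.
  move=> U W _ _ [UW0 UWT]; rewrite !inE !properT UW0 UWT; split; rewrite ?andbT /=.
    apply: contra UWT => /eqP UWT; rewrite -subTset -UWT.
    exact: subset_trans (subsetIl _ _) (subsetUl _ _).
  apply: contra UW0; rewrite setU_eq0 => /andP[/eqP -> _].
  by rewrite set0I.
have submodg : crossing_submodular P g.
  by move=> U W _ _ _; have := dout_submodular D setT U W; rewrite /g; lia.
pose x v : rat := (1 / 2 * (net_out D setT v)%:~R)%R.
have sum_x (U : {set V}) : (\sum_(v in U) x v
    = 1 / 2 * ((dout D [set: A] U)%:Q - (din D [set: A] U)%:Q))%R.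
  by rewrite -mulr_sumr -rmorph_sum sum_net_out rmorphB.
have [||||y [y_le y0]] := @integral_common_base V (fun b => if b then C else P)
  (fun b => if b then f else g) x.
- by case.
- by case.
- case=> U CU; rewrite sum_x; first exact: f_ge.
  move: CU; rewrite inE => /andP[pU nU]; have := connD U pU nU.
  rewrite /g -(ler_nat rat) natrD natrM intrB -!pmulrn; lra.
- rewrite -sum_setT sum_x -dout_setC setCT !dout_sum !big1 ?subrr ?mulr0 //;
    by move=> a _; rewrite !inE.
have [|J _ yJ] := @net_out_realization V A D setT y y0.
  move=> U; have [PU|] := boolP (U \in P).
    by apply: le_trans (y_le false U PU) _; rewrite /g; lia.
  rewrite inE negb_and properT !negbK => /orP[] /eqP ->.
    by rewrite sum_setT y0.
  by rewrite big_set0.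
exists J; split=> [|U CU]; last by rewrite -yJ; apply: (y_le true).
apply/arc_connected_flipE => U pU nU.
(* The arcs entering U are bounded through the arcs leaving its complement. *)
have PU' : ~: U \in P.
  rewrite inE properT; apply/andP.
  by split; rewrite -(inj_eq (@setC_inj _)) setCK ?setCT ?setC0 // -properT.
have := y_le false _ PU'; have := yJ (~: U).
by rewrite /g !dout_setC -[din D J (~: U)]dout_setC setCK; lia.
Qed.
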